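(* For every positive integer $n$, there is an explicit bijection between the set of $n\times n$ magog matrices and the set of magog triangles of order $n$; consequently the set of $n\times n$ magog matrices is in bijection with the set of all totally symmetric self-complementary plane partitions (TSSCPPs) in a $2n\times 2n\times 2n$ box.
   Context: An $n\times n$ square sign matrix is an $n\times n$ matrix $A=(a_{ij})$ with entries in $\{0,1,-1\}$ such that all row sums and all column sums equal $1$, $0\le \sum_{i'=1}^{i}a_{i'j}\le 1$ for all $1\le i,j\le n$, and $\sum_{j'=1}^{j}a_{ij'}\ge 0$ for all $1\le i,j\le n$. An $n\times n$ magog matrix is a square sign matrix which additionally satisfies, for all $1\le i\le n-2$ and $1\le j\le n-2$, $$\sum_{j'=1}^{j}a_{i+1,j'}+\sum_{i'=1}^{i+1}a_{i',j+1}-\sum_{i'=1}^{i}a_{i'j}\ge 0.$$ A magog triangle of order $n$ is a triangular array of integers $(t_{r,k})$, $1\le k\le r\le n$ (row $r$ has $r$ entries $t_{r,1},\dots,t_{r,r}$), such that all entries are at most $n$, each row is strictly increasing ($t_{r,k}<t_{r,k+1}$), $t_{r+1,k+1}\le t_{r,k}+1$ for all $1\le k\le r\le n-1$, and the bottom row is $t_{n,k}=k$ for $1\le k\le n$. A plane partition is a finite set $\pi$ of lattice points $(i,j,k)$ with positive integer coordinates such that if $(i,j,k)\in\pi$ and $1\le i'\le i$, $1\le j'\le j$, $1\le k'\le k$ then $(i',j',k')\in\pi$. It is totally symmetric if it is invariant under all permutations of the three coordinates. A plane partition contained in the box $\{1,\dots,2n\}^3$ is self-complementary in that box if for every $(i,j,k)$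 in the box, $(i,j,k)\in\pi$ if and only if $(2n+1-i,2n+1-j,2n+1-k)\notin\pi$. A TSSCPP in a $2n\times2n\times2n$ box is a plane partition in that box which is both totally symmetric and self-complementary. *)

(* Defs.v *)
From mathcomp Require Import all_boot all_order all_algebra.
From mathcomp Require Import finmap.
From mathcomp Require Import boolp classical_sets functions.

Set Implicit Arguments.
Unset Strict Implicit.
Unset Printing Implicit Defensive.

Import Order.TTheory GRing.Theory Num.Theory.

Local Open Scope ring_scope.

(* Rows and columns are indexed from 0 by 'I_n, so the mathematical index is
   i.+1 for i : 'I_n. The partial sums below include their last index. *)

Definition col_psum n (A : 'M[int]_n) (i j : 'I_n) : int :=
  \sum_(i' < n | (i' <= i)%N) A i' j.

Definition row_psum n (A : 'M[int]_n) (i j : 'I_n) : int :=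
  \sum_(j' < n | (j' <= j)%N) A i j'.

Definition square_sign_matrix n (A : 'M[int]_n) : Prop :=
  [/\ forall i j, A i j \in [:: 0; 1; -1],
      forall i, \sum_(j < n) A i j = 1,
      forall j, \sum_(i < n) A i j = 1,
      forall i j, 0 <= col_psum A i j <= 1
    & forall i j, 0 <= row_psum A i j].

(* i1 and j1 are the successor indices; with i standing for the mathematical
   index i.+1, the range i.+1 <= n - 2 is i.+2 < n. *)
Definition magog_matrix n (A : 'M[int]_n) : Prop :=
  square_sign_matrix A /\
  forall i i1 j j1 : 'I_n,
    i1 = i.+1 :> nat -> j1 = j.+1 :> nat -> (i.+2 < n)%N -> (j.+2 < n)%N ->
    0 <= row_psum A i1 j + col_psum A i1 j1 - col_psum A i j.

(* t r k is the mathematical entry t_(r.+1, k.+1). *)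
Definition triangle n := {dffun forall r : 'I_n, {ffun 'I_r.+1 -> int}}.

Definition magog_triangle n (t : triangle n) : Prop :=
  [/\ forall (r : 'I_n) (k : 'I_r.+1), t r k <= n%:Z,
      forall (r : 'I_n) (k k1 : 'I_r.+1), k1 = k.+1 :> nat -> t r k < t r k1,
      forall (r r1 : 'I_n) (k : 'I_r.+1) (k1 : 'I_r1.+1),
        r1 = r.+1 :> nat -> k1 = k.+1 :> nat -> t r1 k1 <= t r k + 1
    & forall (r : 'I_n) (k : 'I_r.+1), r.+1 = n -> t r k = k.+1%:Z].

(* The increasing list of the (1-based) columns of A whose partial sum down to
   row r is 1. For a square sign matrix it has r.+1 entries. *)
Definition unit_columns n (A : 'M[int]_n) (r : 'I_n) : seq nat :=
  [seq (nat_of_ord j).+1 | j <- enum 'I_n & col_psum A r j == 1].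

Definition triangle_of_matrix n (A : 'M[int]_n) : triangle n :=
  [ffun r : 'I_n => [ffun k : 'I_r.+1 => (nth 0%N (unit_columns A r) k)%:Z]].

Definition lattice_point := (nat * nat * nat)%type.

Definition in_box (m : nat) (p : lattice_point) : bool :=
  [&& (0 < p.1.1 <= m)%N, (0 < p.1.2 <= m)%N & (0 < p.2 <= m)%N].

Definition plane_partition (pi : {fset lattice_point}) : Prop :=
  (forall i j k, (i, j, k) \in pi -> [/\ (0 < i)%N, (0 < j)%N & (0 < k)%N]) /\
  (forall i j k i' j' k',
    (i, j, k) \in pi ->
    (0 < i' <= i)%N -> (0 < j' <= j)%N -> (0 < k' <= k)%N ->
    (i', j', k') \in pi).

Definition totally_symmetric (pi : {fset lattice_point}) : Prop :=
  forall i j k, (i, j, k) \in pi ->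
    [/\ (i, k, j) \in pi, (j, i, k) \in pi, (j, k, i) \in pi,
        (k, i, j) \in pi & (k, j, i) \in pi].

Definition contained_in_box (m : nat) (pi : {fset lattice_point}) : Prop :=
  forall p, p \in pi -> in_box m p.

Definition self_complementary (m : nat) (pi : {fset lattice_point}) : Prop :=
  forall i j k, in_box m (i, j, k) ->
    ((i, j, k) \in pi <->
     ((m.+1 - i)%N, (m.+1 - j)%N, (m.+1 - k)%N) \notin pi).

Definition tsscpp (n : nat) (pi : {fset lattice_point}) : Prop :=
  [/\ plane_partition pi, contained_in_box (2 * n)%N pi, totally_symmetric pi
    & self_complementary (2 * n)%N pi].

(* Main.v *)
(** In row [r] of a square sign matrix the column partial sums are the indicator
    of a set of [r.+1] columns, and the matrix is recovered from these sets.
    Counting the columns of index at most [v] in row [r] turns the conditions on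
    the row sums into inequalities between counts of consecutive rows, which
    amount to the inequalities between the entries of a magog triangle.

    In a TSSCPP in the box of side [2n], call a coordinate large if it exceeds
    [n]. No point has three large coordinates: else (n+1,n+1,n+1) would be a
    point, and so would (n,n,n), which complementation excludes. Hence
    symmetry and complementation determine the TSSCPP from the numbers [h a b]
    of its points (n+1+a, n+1+b, k) with k <= n. These numbers range over
    the symmetric arrays, decreasing in [a] and in [b], with
    h a b <= n-1-b; the bound is what downward closure says when
    a coordinate passes from n+1 to n. Subtracting k from the entry t_(r,k) of a
    magog triangle gives such an array, read off at a = r - k and b = r - 1. *)

Require Import Defs.
From mathcomp Require Import all_boot all_order all_algebra.
From mathcomp Require Import finmap.
From mathcomp Require Import boolp classical_sets functions.
From mathcomp Require Import zify.

Set Implicit Arguments.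
Unset Strict Implicit.
Unset Printing Implicit Defensive.

Import Order.TTheory GRing.Theory Num.Theory.

Local Open Scope ring_scope.

(** * Entries and counts in increasing lists *)

Lemma nth_leq_count (s : seq nat) (v k : nat) :
  sorted ltn s -> (k < size s)%N ->
  (nth 0%N s k <= v)%N = (k < count (fun x => (x <= v)%N) s)%N.
Proof.
elim: s k => [//|x s IHs] k /= x_s k_lt.
have x_le y : y \in s -> (x < y)%N.
  by move: x_s; rewrite path_sortedE; [case/andP=> /allP + _; apply | exact: ltn_trans].
have s_sorted := path_sorted x_s.
case: (leqP x v) => [x_v|v_x].
  by case: k k_lt => [|k] k_lt //=; rewrite IHs.
have -> : count (fun y => (y <= v)%N) s = 0%N.
  apply/eqP; rewrite -leqn0 leqNgt -has_count; apply/hasP=> -[y /x_le].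
  by move=> ? ?; lia.
case: k k_lt => [|k] k_lt /=; first by lia.
by rewrite ltn0 leqNgt (ltn_trans v_x) // x_le // mem_nth.
Qed.

Lemma nth_image_ord m (f : 'I_m -> nat) (k : 'I_m) x0 :
  nth x0 [seq f i | i : 'I_m] k = f k.
Proof. by rewrite (nth_map k) ?size_enum_ord // nth_ord_enum. Qed.

(** * From square sign matrices to triangles *)

Section Matrices.
Context (n : nat).
Implicit Types (A B : 'M[int]_n) (t : triangle n).

Lemma col_psumS A (i i1 j : 'I_n) : i1 = i.+1 :> nat ->
  col_psum A i1 j = col_psum A i j + A i1 j.
Proof.
move=> i1E; rewrite /col_psum (bigD1 i1) //= addrC; congr (_ + _).
by apply: eq_bigl => i'; rewrite -val_eqE /= i1E; lia.
Qed.

Lemma col_psum0 A (i j : 'I_n) : i = 0%N :> nat -> col_psum A i j = A i j.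
Proof.
move=> i0; rewrite /col_psum (big_pred1 i) // => i'.
by rewrite /= -val_eqE /= i0; lia.
Qed.

Lemma col_psum_inj A B :
  (forall i j, col_psum A i j = col_psum B i j) -> A = B.
Proof.
move=> AB; apply/matrixP=> i j.
case iE: (nat_of_ord i) => [|m]; first by rewrite -!col_psum0.
have m_lt : (m < n)%N by have := ltn_ord i; lia.
have mS : i = (Ordinal m_lt).+1 :> nat by [].
have := AB i j; rewrite !(col_psumS _ _ mS) AB.
exact: addrI.
Qed.

(** Counting function of row [i] of the future triangle. The listed columns are 1-based, so column
    [j] starts to count at [v = j.+1]. *)
Definition unit_count A (i : 'I_n) (v : nat) : nat :=
  count (fun x => (x <= v)%N) (unit_columns A i).

Lemma unit_columns_subseq A i : subseq (unit_columns A i) (iota 1 n).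
Proof.
have -> : iota 1 n = [seq (nat_of_ord j).+1 | j <- enum 'I_n].
  by rewrite (iotaDl 1 0) -val_enum_ord -map_comp.
exact/map_subseq/filter_subseq.
Qed.

Lemma unit_columns_sorted A i : sorted ltn (unit_columns A i).
Proof.
exact: subseq_sorted ltn_trans _ _ (unit_columns_subseq A i) (iota_ltn_sorted _ _).
Qed.

Lemma unit_columns_bound A i x : x \in unit_columns A i -> (0 < x <= n)%N.
Proof. by move/(mem_subseq (unit_columns_subseq A i)); rewrite mem_iota; lia. Qed.

Lemma mem_unit_columns A i (j : 'I_n) :
  (j.+1 \in unit_columns A i) = (col_psum A i j == 1).
Proof.
apply/mapP/idP => [[j' + [/val_inj ->]]|ij]; first by rewrite mem_filter => /andP[].
by exists j => //; rewrite mem_filter ij mem_enum.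
Qed.

Lemma unit_countE A i v : (forall i j, 0 <= col_psum A i j <= 1) ->
  (unit_count A i v)%:Z = \sum_(j < n | (j < v)%N) col_psum A i j.
Proof.
move=> A01; rewrite /unit_count /unit_columns count_map count_filter -sum1_count.
rewrite big_enum_cond /= -natz natr_sum big_mkcondr /=.
apply: eq_bigr => j _ /=.
have := A01 i j; case: eqP => [-> //|].
by move=> ? ?; have /eqP -> : col_psum A i j == 0 by lia.
Qed.

Lemma unit_countS A (i j : 'I_n) : (forall i j, 0 <= col_psum A i j <= 1) ->
  (unit_count A i j.+1)%:Z = (unit_count A i j)%:Z + col_psum A i j.
Proof.
move=> A01; rewrite !unit_countE // (bigD1 j) //= addrC; congr (_ + _).
by apply: eq_bigl => j'; rewrite -val_eqE /=; lia.
Qed.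

Lemma unit_count_size A i : unit_count A i n = size (unit_columns A i).
Proof.
by apply/eqP; rewrite -all_count; apply/allP=> x /unit_columns_bound /andP[].
Qed.

Lemma unit_count_le A (i : 'I_n) v : (forall i j, 0 <= col_psum A i j <= 1) ->
  (v <= n)%N -> (unit_count A i v <= v)%N.
Proof.
move=> A01; elim: v => [_|v IHv v_lt].
  by have := unit_countE i 0 A01; rewrite big_pred0 //; lia.
have := A01 i (Ordinal v_lt); have := unit_countS i (Ordinal v_lt) A01.
by rewrite /=; lia.
Qed.

(** Row [i1] is the difference of the column partial sums of two consecutive rows. Nonnegative
    partial row sums thus mean that counts do not decrease from a row to the next. *)
Lemma row_psumE A (i i1 j : 'I_n) : i1 = i.+1 :> nat ->
  (forall i j, 0 <= col_psum A i j <= 1) ->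
  row_psum A i1 j = (unit_count A i1 j.+1)%:Z - (unit_count A i j.+1)%:Z.
Proof.
move=> i1E A01; rewrite !unit_countE // -sumrB; apply: eq_bigr => j' _.
by rewrite (col_psumS _ _ i1E) addrAC subrr add0r.
Qed.

(** Each new row has sum 1, so it raises the total of the column partial sums by 1. *)
Lemma size_unit_columns A i : (forall i j, 0 <= col_psum A i j <= 1) ->
  (forall i, \sum_(j < n) A i j = 1) -> size (unit_columns A i) = i.+1.
Proof.
move=> A01 rowA; rewrite -unit_count_size.
suff : (unit_count A i n)%:Z = i.+1%:Z by case.
rewrite unit_countE //; under eq_bigl do rewrite ltn_ord.
have [m] := ubnP (nat_of_ord i); elim: m i => // m IHm i i_lt.
case iE: (nat_of_ord i) => [|k].
  by rewrite -[1%N%:Z]/(1 : int) -(rowA i); apply: eq_bigr => j _; rewrite col_psum0.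
have k_lt : (k < n)%N by have := ltn_ord i; lia.
have kS : i = (Ordinal k_lt).+1 :> nat by [].
under eq_bigr do rewrite (col_psumS _ _ kS).
by rewrite big_split /= rowA IHm /=; lia.
Qed.

(** This duality turns inequalities between triangle entries into inequalities between counts. *)
Lemma nth_unit_columns A i v k : (k < size (unit_columns A i))%N ->
  (nth 0%N (unit_columns A i) k <= v)%N = (k < unit_count A i v)%N.
Proof. exact/nth_leq_count/unit_columns_sorted. Qed.

Lemma unit_columns_last A (i : 'I_n) : i.+1 = n ->
  (forall j, \sum_(i < n) A i j = 1) -> unit_columns A i = iota 1 n.
Proof.
move=> iE colA; rewrite (iotaDl 1 0) -val_enum_ord -map_comp /unit_columns.
rewrite (@eq_filter _ _ predT) ?filter_predT // => j /=; apply/eqP.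
by rewrite -(colA j); apply: eq_bigl => i'; have := ltn_ord i'; lia.
Qed.

Lemma triangle_of_matrixE A i k :
  triangle_of_matrix A i k = (nth 0%N (unit_columns A i) k)%:Z.
Proof. by rewrite !ffunE. Qed.

(** The substance is the diagonal inequality: it comes from the magog inequality at the column
    listed by the entry in row [r], where the column partial sum is 1. *)
Lemma magog_triangle_of_matrix A :
  magog_matrix A -> magog_triangle (triangle_of_matrix A).
Proof.
move=> [[Ae rowA colA A01 A_row] A_magog].
have sizeA := size_unit_columns _ A01 rowA.
have mem_nthA (i : 'I_n) k : (k <= i)%N ->
  nth 0%N (unit_columns A i) k \in unit_columns A i.
  by move=> ki; apply: mem_nth; rewrite sizeA.
split=> [r k|r k k1 k1E|r r1 k k1 r1E k1E|r k rE].
- rewrite triangle_of_matrixE.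
  by have /unit_columns_bound := mem_nthA r k (ltn_ord k); lia.
- rewrite !triangle_of_matrixE k1E ltz_nat.
  apply: (sorted_ltn_nth ltn_trans _ (unit_columns_sorted A r)) => //;
    by rewrite inE sizeA; have := ltn_ord k1; lia.
- rewrite !triangle_of_matrixE.
  have := mem_nthA r k (ltn_ord k); set v := nth _ _ k => v_in.
  have v_n := unit_columns_bound v_in.
  have kv : (k < unit_count A r v)%N by rewrite -nth_unit_columns ?sizeA.
  suff : (nth 0%N (unit_columns A r1) k1 <= v.+1)%N by lia.
  (* If [r1] is the last row, the entry is [k.+2], and [k < unit_count A r v <= v]. *)
  have [r1_lt|r1_ge] := ltnP r1.+1 n; last first.
    have r1n : r1.+1 = n by have := ltn_ord r1; lia.
    have := unit_count_le r A01 (andP v_n).2.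
    by rewrite unit_columns_last // nth_iota; have := ltn_ord k1; lia.
  (* If [v.+1 >= n], the bound holds because listed columns are at most [n]. *)
  have [v_lt|v_ge] := ltnP v.+1 n; last first.
    by have := unit_columns_bound (mem_nthA r1 k1 (ltn_ord k1)); lia.
  rewrite nth_unit_columns; last by rewrite sizeA.
  have [j jE] : exists j : 'I_n, v = j.+1.
    by case/mapP: v_in => j _ ->; exists j.
  have j1_lt : (j.+1 < n)%N by lia.
  (* In terms of counts this reads [unit_count A r j.+1 + col_psum A r j <= unit_count A r1 j.+2],
     with [col_psum A r j = 1]. *)
  have := A_magog r r1 j (Ordinal j1_lt) r1E erefl.
  have := unit_countS r1 (Ordinal j1_lt) A01.
  move: v_in kv; rewrite jE mem_unit_columns => /eqP -> kv.
  by rewrite (row_psumE _ r1E) //=; lia.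
- rewrite triangle_of_matrixE unit_columns_last // nth_iota //.
  by have := ltn_ord k; lia.
Qed.

Lemma triangle_of_matrix_inj A B : magog_matrix A -> magog_matrix B ->
  triangle_of_matrix A = triangle_of_matrix B -> A = B.
Proof.
move=> [[_ rowA _ A01 _] _] [[_ rowB _ B01 _] _] AB.
have uAB i : unit_columns A i = unit_columns B i.
  apply: (@eq_from_nth _ 0%N) => [|k]; rewrite !size_unit_columns // => k_lt.
  have := congr1 (fun t : triangle n => t i (Ordinal k_lt)) AB.
  by rewrite !triangle_of_matrixE => -[].
apply: col_psum_inj => i j; have := mem_unit_columns A i j.
rewrite uAB mem_unit_columns; have := A01 i j; have := B01 i j.
by case: eqP; case: eqP; lia.
Qed.

(** * The inverse map, from triangles to matrices *)

Lemma magog_triangle_ge t (r : 'I_n) (k : 'I_r.+1) :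
  magog_triangle t -> k.+1%:Z <= t r k.
Proof.
move=> [_ _ diag bottom].
(* Induction down the diagonal: each step raises the entry by at most 1, and it ends in the bottom
   row, whose entries are known. *)
have [m] := ubnP (n - r); elim: m r k => // m IHm r k r_lt.
have r_n := ltn_ord r.
have [rE|r1_lt] := eqVneq r.+1 n; first by rewrite bottom.
have r1_n : (r.+1 < n)%N by lia.
have k1_lt : (k.+1 < r.+2)%N by have := ltn_ord k; lia.
have := diag r (Ordinal r1_n) k (Ordinal k1_lt) erefl erefl.
have := IHm (Ordinal r1_n) (Ordinal k1_lt).
by rewrite /=; lia.
Qed.

Definition unit_of_triangle t (i j : 'I_n) : bool :=
  [exists k, t i k == j.+1%:Z].

(* The second indicator is that of the preceding row, absent for row 0. *)
Definition matrix_of_triangle t : 'M[int]_n :=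
  \matrix_(i, j) ((unit_of_triangle t i j)%:Z -
    [exists i0 : 'I_n, (i == i0.+1 :> nat) && unit_of_triangle t i0 j]%:Z).

(** The differences defining the entries telescope down each column. *)
Lemma col_psum_matrix_of_triangle t i j :
  col_psum (matrix_of_triangle t) i j = (unit_of_triangle t i j)%:Z.
Proof.
have [m] := ubnP (nat_of_ord i); elim: m i => // m IHm i i_lt.
case iE: (nat_of_ord i) => [|k].
  rewrite col_psum0 // mxE [X in _ - X%:Z](_ : _ = 0%N) ?subr0 //.
  by case: existsP => // -[i0]; rewrite iE.
have k_lt : (k < n)%N by have := ltn_ord i; lia.
have kS : i = (Ordinal k_lt).+1 :> nat by [].
rewrite (col_psumS _ _ kS) IHm /=; last by lia.
rewrite mxE; suff -> : [exists i0 : 'I_n, (i == i0.+1 :> nat) &&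
    unit_of_triangle t i0 j] = unit_of_triangle t (Ordinal k_lt) j by lia.
apply/existsP/idP => [[i0 /andP[/eqP i0E]]|kj].
  by rewrite (_ : i0 = Ordinal k_lt) //; apply: val_inj; rewrite /=; lia.
by exists (Ordinal k_lt); rewrite iE eqxx.
Qed.

(** Both lists are strictly increasing with the same elements; absolute values change nothing, as
    the entries of a magog triangle are positive. *)
Lemma unit_columns_matrix_of_triangle t i : magog_triangle t ->
  unit_columns (matrix_of_triangle t) i =
  [seq `|t i k|%N | k : 'I_i.+1].
Proof.
move=> t_magog; have [t_n t_lt _ _] := t_magog.
have t_gt0 k := magog_triangle_ge k t_magog.
apply: (irr_sorted_eq ltn_trans ltnn) => [||x]; first exact: unit_columns_sorted.
  apply/(sortedP 0%N) => k; rewrite size_map size_enum_ord => k_lt.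
  have k_lt' : (k < i.+1)%N by lia.
  have := nth_image_ord (fun k => `|t i k|%N) (Ordinal k_lt) 0%N.
  have := nth_image_ord (fun k => `|t i k|%N) (Ordinal k_lt') 0%N => /= -> ->.
  have := t_lt i (Ordinal k_lt') (Ordinal k_lt) erefl.
  by have := t_gt0 i (Ordinal k_lt'); lia.
apply/idP/mapP => [x_in|[k _ ->]].
  have /andP[x_gt0 x_n] := unit_columns_bound x_in.
  have x1_lt : (x.-1 < n)%N by lia.
  have xE : x = (Ordinal x1_lt).+1 by rewrite /=; lia.
  move: x_in; rewrite {1}xE mem_unit_columns col_psum_matrix_of_triangle.
  rewrite /unit_of_triangle; case: existsP => // -[k /eqP tE] _; exists k; rewrite ?mem_enum // tE /=; lia.
have := t_n i k; have := t_gt0 i k => ? ?.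
have x1_lt : (`|t i k|.-1 < n)%N by lia.
have tE : `|t i k|%N = (Ordinal x1_lt).+1 by rewrite /=; lia.
rewrite tE mem_unit_columns col_psum_matrix_of_triangle /unit_of_triangle.
by case: existsP => // -[]; exists k => /=; lia.
Qed.

Lemma nth_unit_columns_matrix_of_triangle t (i : 'I_n) (k : 'I_i.+1) :
  magog_triangle t ->
  nth 0%N (unit_columns (matrix_of_triangle t) i) k = `|t i k|%N.
Proof.
move=> t_magog; rewrite unit_columns_matrix_of_triangle //.
exact: nth_image_ord.
Qed.

Lemma matrix_of_triangleK t : magog_triangle t ->
  triangle_of_matrix (matrix_of_triangle t) = t.
Proof.
move=> t_magog; apply/ffunP=> r; apply/ffunP=> k.
rewrite triangle_of_matrixE nth_unit_columns_matrix_of_triangle //.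
by rewrite gez0_abs //; apply: le_trans (magog_triangle_ge k t_magog).
Qed.

(** Nonnegativity of the partial row sums and the magog inequality follow from two comparisons of
    counts in consecutive rows, [uc_mono] and [ucS]. *)
Lemma magog_matrix_of_triangle t :
  magog_triangle t -> magog_matrix (matrix_of_triangle t).
Proof.
move=> t_magog; have [t_n t_lt t_diag t_bot] := t_magog.
set A := matrix_of_triangle t.
have t_gt0 (r : 'I_n) (k : 'I_r.+1) := magog_triangle_ge k t_magog.
have A01 i j : 0 <= col_psum A i j <= 1.
  by rewrite col_psum_matrix_of_triangle; case: unit_of_triangle.
have sizeA i : size (unit_columns A i) = i.+1.
  by rewrite unit_columns_matrix_of_triangle // size_map size_enum_ord.
have uc_nth (i : 'I_n) v (k : 'I_i.+1) : (t i k <= v%:Z) = (k < unit_count A i v)%N.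
  rewrite -nth_unit_columns ?sizeA // nth_unit_columns_matrix_of_triangle //.
  by have := t_gt0 i k; lia.
have uc_le i v : (unit_count A i v <= i.+1)%N by rewrite -(sizeA i) count_size.
(* The last entry counted in row [i] is at most [v], so the one diagonally below it is at most
   [v.+1]; this gives one more counted entry. *)
have ucS (i i1 : 'I_n) v : i1 = i.+1 :> nat ->
  (0 < unit_count A i v)%N -> (unit_count A i v < unit_count A i1 v.+1)%N.
  move=> i1E uc_gt0; have uc_i := uc_le i v.
  have k_lt : ((unit_count A i v).-1 < i.+1)%N by lia.
  have k1_lt : (unit_count A i v < i1.+1)%N by lia.
  have := t_diag _ _ (Ordinal k_lt) (Ordinal k1_lt) i1E.
  have := uc_nth i v (Ordinal k_lt).
  have := uc_nth i1 v.+1 (Ordinal k1_lt).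
  by rewrite /=; lia.
(* In row [i1] the entry just before the diagonal one is strictly smaller, hence at most [v]. *)
have uc_mono (i i1 : 'I_n) v : i1 = i.+1 :> nat ->
  (unit_count A i v <= unit_count A i1 v)%N.
  move=> i1E; have [->//|uc_gt0] := posnP (unit_count A i v).
  have uc_i := uc_le i v.
  have k_lt : ((unit_count A i v).-1 < i.+1)%N by lia.
  have k1_lt : (unit_count A i v < i1.+1)%N by lia.
  have k0_lt : ((unit_count A i v).-1 < i1.+1)%N by lia.
  have := t_diag _ _ (Ordinal k_lt) (Ordinal k1_lt) i1E.
  have := t_lt i1 (Ordinal k0_lt) (Ordinal k1_lt).
  have := uc_nth i v (Ordinal k_lt).
  have := uc_nth i1 v (Ordinal k0_lt).
  by rewrite /=; lia.
have col_psum_row_sum i : \sum_(j < n) col_psum A i j = i.+1%:Z.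
  rewrite -(sizeA i) -unit_count_size unit_countE //.
  by apply: eq_bigl => j; rewrite ltn_ord.
split; first split=> // [i j|i|j|i j].
- rewrite mxE; case: unit_of_triangle; case: [exists _, _]; by rewrite !inE.
- case iE: (nat_of_ord i) => [|m].
    under eq_bigr do rewrite -(col_psum0 _ _ iE).
    by rewrite col_psum_row_sum iE.
  have m_lt : (m < n)%N by have := ltn_ord i; lia.
  have mS : i = (Ordinal m_lt).+1 :> nat by [].
  have := col_psum_row_sum i; under eq_bigr do rewrite (col_psumS _ _ mS).
  rewrite big_split /= col_psum_row_sum /= => E.
  by apply: (@addrI _ m.+1%:Z); rewrite E iE; lia.
- have n1_lt : (n.-1 < n)%N by have := ltn_ord j; lia.
  have j_lt : (j < (Ordinal n1_lt).+1)%N by have := ltn_ord j; rewrite /=; lia.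
  transitivity (col_psum A (Ordinal n1_lt) j).
    by apply: eq_bigl => i; have := ltn_ord i; rewrite /=; lia.
  rewrite col_psum_matrix_of_triangle /unit_of_triangle; case: existsP => // -[].
  by exists (Ordinal j_lt); rewrite t_bot //=; lia.
- case iE: (nat_of_ord i) => [|m].
    by rewrite sumr_ge0 // => j' _; rewrite -col_psum0 //; case/andP: (A01 i j').
  have m_lt : (m < n)%N by have := ltn_ord i; lia.
  have mS : i = (Ordinal m_lt).+1 :> nat by [].
  by rewrite (row_psumE _ mS) //; have := uc_mono _ _ j.+1 mS; lia.
(* If [unit_count A i j.+1] is positive, [ucS] gives the inequality; otherwise [col_psum A i j] is 0
   too and the expression equals [unit_count A i1 j.+2]. *)
move=> i i1 j j1 i1E j1E _ _.
rewrite (row_psumE _ i1E) //.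
have := unit_countS i j A01; have := unit_countS i1 j1 A01; rewrite j1E.
have := ucS _ _ j.+1 i1E; have := uc_mono _ _ j.+1 i1E.
have := A01 i j; have := A01 i1 j1.
have := uc_mono _ _ j.+2 i1E; lia.
Qed.

End Matrices.

Lemma triangle_of_matrix_bij n :
  set_bij [set A : 'M[int]_n | magog_matrix A]%classic
          [set t : triangle n | magog_triangle t]%classic
          (@triangle_of_matrix n).
Proof.
split.
- by move=> A; exact: magog_triangle_of_matrix.
- by move=> A B /set_mem A_magog /set_mem B_magog; exact: triangle_of_matrix_inj.
- move=> t t_magog; exists (matrix_of_triangle t).
    exact: magog_matrix_of_triangle.
  exact: matrix_of_triangleK.
Qed.

(** * Plane partitions built from height arrays *)

Lemma leq_count_iota (P : pred nat) n k :
  (forall i j, (0 < i <= j)%N -> P j -> P i) -> (0 < k <= n)%N ->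
  (k <= count P (iota 1 n))%N = P k.
Proof.
move=> P_down /andP[k_gt0 k_n].
(* If [P k] holds, the block before [k] is full and contributes [k.-1]; otherwise the block from [k]
   on contributes nothing. *)
have -> : iota 1 n = iota 1 k.-1 ++ iota k (n - k.-1).
  by rewrite -{2}(prednK k_gt0) -add1n -iotaD; congr iota; lia.
rewrite count_cat; have [Pk|notPk] := boolP (P k).
  have /eqP -> : count P (iota 1 k.-1) == k.-1.
    rewrite -[X in _ == X](size_iota 1) -all_count; apply/allP=> i.
    by rewrite mem_iota => i_k; apply: P_down Pk; lia.
  rewrite (_ : (n - k.-1)%N = (n - k).+1) /= ?Pk; lia.
have -> : count P (iota k (n - k.-1)) = 0%N.
  apply/eqP; rewrite -leqn0 leqNgt -has_count; apply/hasPn=> i.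
  rewrite mem_iota => i_k; apply: contra notPk; apply: P_down; lia.
by have := count_size P (iota 1 k.-1); rewrite size_iota; lia.
Qed.

(** Indices range over all naturals; symmetry and truncated subtraction force the value 0 once
    either index reaches [n.-1], so a finite square determines the array. *)
Definition height_array (n : nat) (h : nat -> nat -> nat) : Prop :=
  [/\ forall a b, h a b = h b a,
      forall a a' b, (a <= a')%N -> (h a' b <= h a b)%N
    & forall a b, (h a b <= n.-1 - b)%N].

Section Points.
Variables (n : nat) (h : nat -> nat -> nat).

Let under_height x y z : bool := (z <= h (x - n.+1) (y - n.+1))%N.
Let opp v : nat := ((2 * n).+1 - v)%N.

(* Points with at most one large coordinate are decided by their complement. *)
Definition height_point (x y z : nat) : bool :=
  match (n < x)%N, (n < y)%N, (n < z)%N with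
  | true, true, true => false
  | true, true, false => under_height x y z
  | true, false, true => under_height x z y
  | false, true, true => under_height y z x
  | true, false, false => ~~ under_height (opp y) (opp z) (opp x)
  | false, true, false => ~~ under_height (opp x) (opp z) (opp y)
  | false, false, true => ~~ under_height (opp x) (opp y) (opp z)
  | false, false, false => true
  end.

Definition box_points : seq lattice_point :=
  [seq (xy, z) | xy <- [seq (x, y) | x <- iota 1 (2 * n), y <- iota 1 (2 * n)],
                 z <- iota 1 (2 * n)].

Definition height_pp : {fset lattice_point} :=
  [fset p in box_points | height_point p.1.1 p.1.2 p.2]%fset.

Lemma mem_box_points p : (p \in box_points) = in_box (2 * n) p.
Proof.
case: p => -[x y] z; rewrite /in_box /=; apply/allpairsP/idP.
  move=> [[[x' y'] z'] [/allpairsP[[x2 y2] [/= + + [-> ->]]] + [-> -> ->]]].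
  by rewrite !mem_iota /=; lia.
move=> xyz; exists ((x, y), z); split; rewrite ?mem_iota //=; last by lia.
by apply/allpairsP; exists (x, y); split; rewrite ?mem_iota //=; lia.
Qed.

Lemma mem_height_pp x y z :
  ((x, y, z) \in height_pp) = in_box (2 * n) (x, y, z) && height_point x y z.
Proof. by rewrite !inE mem_box_points. Qed.

Hypothesis h_array : height_array n h.

Lemma height_pointC x y z : height_point x y z = height_point y x z.
Proof.
case: h_array => hC _ _; rewrite /height_point /under_height.
by case: ltnP => _; case: ltnP => _; case: ltnP => _ //; rewrite hC.
Qed.

Lemma height_pointCr x y z : height_point x y z = height_point x z y.
Proof.
case: h_array => hC _ _; rewrite /height_point /under_height.
by case: ltnP => _; case: ltnP => _; case: ltnP => _ //; rewrite hC.
Qed.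

Lemma height_point_le x x' y z :
  in_box (2 * n) (x, y, z) -> (0 < x' <= x)%N ->
  height_point x y z -> height_point x' y z.
Proof.
case: h_array => hC h_mono h_bound; rewrite /in_box /= => xyz x'_x.
rewrite /height_point /under_height /opp.
case: (ltnP n x) => x_n; case: (ltnP n x') => x'_n;
  case: (ltnP n y) => y_n; case: (ltnP n z) => z_n //; try lia.
- by move=> xyh; apply: leq_trans xyh (h_mono _ _ _ _); lia.
- by move=> xyh; apply: leq_trans xyh (h_mono _ _ _ _); lia.
(* Here [x] passes from large to small while [y] is large. The bound at the old point gives
   [z <= 2 * n - y]; failure at the new one would need [2 * n + 1 - y <= z - 1]. *)
- have := h_bound (x - n.+1)%N (y - n.+1)%N.
  by have := h_bound ((2 * n).+1 - x' - n.+1)%N ((2 * n).+1 - z - n.+1)%N; lia.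
- have := h_bound (x - n.+1)%N (z - n.+1)%N.
  by have := h_bound ((2 * n).+1 - x' - n.+1)%N ((2 * n).+1 - y - n.+1)%N; lia.
- apply: contra => xyh; apply: leq_trans xyh (h_mono _ _ _ _); lia.
- apply: contra => xyh; apply: leq_trans xyh (h_mono _ _ _ _); lia.
Qed.

(** Complementation exchanges small and large coordinates, so it pairs off the eight cases of
    [height_point], with opposite values in each pair. *)
Lemma height_point_opp x y z : in_box (2 * n) (x, y, z) ->
  height_point x y z = ~~ height_point (opp x) (opp y) (opp z).
Proof.
rewrite /in_box /= => xyz.
have opp_gt v : (0 < v <= 2 * n)%N -> (n < opp v)%N = ~~ (n < v)%N.
  by rewrite /opp; lia.
have oppK v : (0 < v <= 2 * n)%N -> opp (opp v) = v by rewrite /opp; lia.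
case/and3P: xyz => x_b y_b z_b; rewrite /height_point !opp_gt // !oppK //.
by case: ltnP => _; case: ltnP => _; case: ltnP => _; rewrite //= ?negbK.
Qed.

Lemma height_pp_tsscpp : tsscpp n height_pp.
Proof.
split.
- split=> [i j k|i j k i' j' k']; first by rewrite mem_height_pp /in_box /=; split; lia.
  rewrite !mem_height_pp => /andP[ijk hp] i'_i j'_j k'_k; apply/andP; split.
    by move: ijk; rewrite /in_box /=; lia.
  (* Coordinates are lowered one at a time, each brought to the first place by symmetry. *)
  apply: (@height_point_le i) => //; first by move: ijk; rewrite /in_box /=; lia.
  rewrite height_pointC.
  apply: (@height_point_le j) => //; first by move: ijk; rewrite /in_box /=; lia.
  rewrite height_pointC height_pointCr height_pointC.
  apply: (@height_point_le k) => //; first by move: ijk; rewrite /in_box /=; lia.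
  by rewrite height_pointC height_pointCr.
- by move=> [[x y] z]; rewrite mem_height_pp => /andP[].
- move=> i j k; rewrite !mem_height_pp /in_box /= => /andP[/and3P[-> -> ->]] ijk /=.
  have ikj : height_point i k j by rewrite height_pointCr.
  have jik : height_point j i k by rewrite height_pointC.
  have jki : height_point j k i by rewrite height_pointCr.
  have kij : height_point k i j by rewrite height_pointC.
  by split=> //; rewrite height_pointC.
- move=> i j k ijk; rewrite !mem_height_pp ijk /= height_point_opp // negb_and.
  have -> : in_box (2 * n) (opp i, opp j, opp k).
    by move: ijk; rewrite /in_box /opp /=; lia.
  by [].
Qed.

Lemma height_arrayE a b k : (a < n)%N -> (b < n)%N -> (0 < k <= n)%N ->
  (k <= h a b)%N = ((n.+1 + a, n.+1 + b, k)%N \in height_pp).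
Proof.
move=> a_n b_n k_n; have n_lt c : (n < n.+1 + c)%N by lia.
have k_le : (n < k)%N = false by lia.
rewrite mem_height_pp /height_point /under_height !n_lt k_le !addKn.
by rewrite (_ : in_box _ _) // /in_box /=; lia.
Qed.

End Points.

Lemma height_pp_inj n h h' : height_array n h -> height_array n h' ->
  height_pp n h = height_pp n h' -> forall a b, h a b = h' a b.
Proof.
move=> hA h'A hh' a b.
have [hC _ hB] := hA; have [h'C _ h'B] := h'A.
have := hB a b; have := hB b a; have := h'B a b; have := h'B b a.
rewrite (hC b) (h'C b).
have [a_n|a_n] := ltnP a n; last by lia.
have [b_n|b_n] := ltnP b n; last by lia.
have E k : (0 < k <= n)%N -> (k <= h a b)%N = (k <= h' a b)%N.
  by move=> k_n; rewrite !(@height_arrayE n) // hh'.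
(* Taking [k] to be either value gives both inequalities. *)
by have := E (h a b); have := E (h' a b); lia.
Qed.

(** * Reading the height array off a TSSCPP *)

Definition pp_height n (pi : {fset lattice_point}) (a b : nat) : nat :=
  count (fun k => (n.+1 + a, n.+1 + b, k)%N \in pi) (iota 1 n).

Section Tsscpp.
Variables (n : nat) (pi : {fset lattice_point}).
Hypothesis pi_tsscpp : tsscpp n pi.

Lemma tsscppC x y z : ((x, y, z) \in pi) = ((y, x, z) \in pi).
Proof. by case: pi_tsscpp => _ _ sym _; apply/idP/idP => /sym[]. Qed.

Lemma tsscppCr x y z : ((x, y, z) \in pi) = ((x, z, y) \in pi).
Proof. by case: pi_tsscpp => _ _ sym _; apply/idP/idP => /sym[]. Qed.

Lemma leq_pp_height a b k : (0 < k <= n)%N ->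
  (k <= pp_height n pi a b)%N = ((n.+1 + a, n.+1 + b, k)%N \in pi).
Proof.
case: pi_tsscpp => -[_ down] _ _ _ k_n.
apply: leq_count_iota k_n => i j i_j /down; apply; lia.
Qed.

Lemma tsscpp_opp x y z : in_box (2 * n) (x, y, z) ->
  ((x, y, z) \in pi) =
  (((2 * n).+1 - x, (2 * n).+1 - y, (2 * n).+1 - z)%N \notin pi).
Proof. by case: pi_tsscpp => _ _ _ sc /sc E; apply/idP/idP => /E. Qed.

Lemma pp_height_array : height_array n (pp_height n pi).
Proof.
have [[pos down] box sym sc] := pi_tsscpp.
split=> [a b|a a' b a_a'|a b].
- by apply: eq_count => k; rewrite tsscppC.
- apply: sub_count => k /[dup] /pos[_ _ k_gt0] /down; apply; lia.
- rewrite leqNgt; apply/negP => lt_h.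
  have h_n : (pp_height n pi a b <= n)%N.
    by rewrite (leq_trans (count_size _ _)) // size_iota.
  have := leqnn (pp_height n pi a b); rewrite {1}leq_pp_height; last by lia.
  move=> /[dup] /box; rewrite /in_box /= => ab_box /down in_pi.
  (* The complement of [(n, n+1+b, n-b)] is [(n+1, n-b, n+1+b)], a permutation of
     [(n+1, n+1+b, n-b)]; too large a height would put both in [pi]. *)
  have c_in : (n.+1, n.+1 + b, n - b)%N \in pi by apply: in_pi; lia.
  have c_in' : (n, n.+1 + b, n - b)%N \in pi by apply: in_pi; lia.
  move: c_in'; rewrite tsscpp_opp; last by rewrite /in_box /=; lia.
  rewrite tsscppCr.
  rewrite (_ : (2 * n).+1 - n = n.+1)%N; last by lia.
  rewrite (_ : (2 * n).+1 - (n - b) = n.+1 + b)%N; last by lia.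
  rewrite (_ : (2 * n).+1 - (n.+1 + b) = n - b)%N; last by lia.
  by rewrite c_in.
Qed.

Lemma tsscpp_large x y z : (n < x)%N -> (n < y)%N -> (n < z)%N ->
  (x, y, z) \notin pi.
Proof.
have [[pos down] box sym sc] := pi_tsscpp.
move=> x_n y_n z_n; apply/negP => /[dup] /box; rewrite /in_box /= => xyz /down xyz_down.
have in1 : (n.+1, n.+1, n.+1) \in pi by apply: xyz_down; lia.
have inn : (n, n, n) \in pi by apply: xyz_down; lia.
move: in1; rewrite tsscpp_opp; last by rewrite /in_box /=; lia.
by rewrite (_ : (2 * n).+1 - n.+1 = n)%N ?inn; last by lia.
Qed.

Lemma pp_heightK : height_pp n (pp_height n pi) = pi.
Proof.
have [[pos down] box sym sc] := pi_tsscpp.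
(* Two large coordinates and one small: these points are read off directly. Symmetry permutes them,
   and complementation turns one large coordinate into two. *)
have LLS x y z : (n < x)%N -> (n < y)%N -> (0 < z <= n)%N ->
    (z <= pp_height n pi (x - n.+1) (y - n.+1))%N = ((x, y, z) \in pi).
  by move=> x_n y_n z_n; rewrite leq_pp_height // !subnKC.
apply/fsetP=> -[[x y] z]; rewrite mem_height_pp.
have [xyz|] /= := boolP (in_box _ _); last first.
  by move=> notbox; apply/esym/negbTE; apply: contra notbox => /box.
have /and3P[/= x_b y_b z_b] := xyz.
rewrite /height_point.
case: (ltnP n x) => x_n; case: (ltnP n y) => y_n; case: (ltnP n z) => z_n.
- by apply/esym/negbTE; apply: tsscpp_large.
- by rewrite LLS //; lia.
- by rewrite LLS //; [rewrite tsscppCr | lia].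
- rewrite LLS; try lia; rewrite [RHS]tsscpp_opp // tsscppC tsscppCr.
  by rewrite tsscppC tsscppCr tsscppC tsscppCr.
- rewrite LLS //; last by lia.
  by rewrite tsscppCr tsscppC.
- rewrite LLS; try lia.
  by rewrite [RHS]tsscpp_opp // tsscppCr.
- rewrite LLS; try lia.
  by rewrite [RHS]tsscpp_opp.
(* Three small coordinates: the complement has three large ones. *)
- rewrite tsscpp_opp //; apply/esym/tsscpp_large; lia.
Qed.

End Tsscpp.

(** * Magog triangles as height arrays *)

Section Heights.
Context (n : nat).
Implicit Types (t : triangle n).

(** The larger index is the row and the smaller one the diagonal, so symmetry is built in. Position
    [r - minn a b] is 0-based, hence the successor subtracted; rows outside the triangle get 0. *)
Definition triangle_height t (a b : nat) : nat :=
  if insub (maxn a b) is Some r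
  then `|t r (inord (r - minn a b)) - (r - minn a b).+1%:Z|%N else 0%N.

Definition triangle_of_height (h : nat -> nat -> nat) : triangle n :=
  [ffun r : 'I_n => [ffun k : 'I_r.+1 => (h (r - k) r + k.+1)%N%:Z]].

Lemma triangle_heightC t a b : triangle_height t a b = triangle_height t b a.
Proof. by rewrite /triangle_height maxnC minnC. Qed.

Lemma triangle_height_out t a b : (n <= maxn a b)%N -> triangle_height t a b = 0%N.
Proof. by move=> ab; rewrite /triangle_height insubF //; lia. Qed.

Lemma triangle_heightE t a (r : 'I_n) (k : 'I_r.+1) :
  magog_triangle t -> (a + k = r)%N ->
  (triangle_height t a r)%:Z = t r k - k.+1%:Z.
Proof.
move=> t_magog ak; rewrite /triangle_height.
have -> : maxn a r = r by lia.
rewrite valK (_ : (r - minn a r)%N = k); last by lia.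
by rewrite inord_val gez0_abs // subr_ge0 magog_triangle_ge.
Qed.

(** The [r - k] entries after [t r k] keep strictly increasing and stay at most [n]. *)
Lemma magog_triangle_le t (r : 'I_n) (k : 'I_r.+1) :
  magog_triangle t -> t r k + (r - k)%N%:Z <= n%:Z.
Proof.
move=> [t_n t_lt _ _].
have [m] := ubnP (r - k); elim: m k => // m IHm k k_m.
have := ltn_ord k => k_r.
have [rk|k_lt] := leqP r k; first by have := t_n r k; lia.
have k1_lt : (k.+1 < r.+1)%N by lia.
have := t_lt r k (Ordinal k1_lt) erefl.
by have := IHm (Ordinal k1_lt); rewrite /=; lia.
Qed.

Lemma triangle_height_array t :
  magog_triangle t -> height_array n (triangle_height t).
Proof.
move=> t_magog; have [_ t_lt t_diag _] := t_magog.
have step a b : (triangle_height t a.+1 b <= triangle_height t a b)%N.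
  have [out|] := leqP n (maxn a.+1 b); first by rewrite triangle_height_out.
  (* For [a < b] the two values come from adjacent entries of row [b], and strict increase compares
     them. *)
  have [ab|ba] := ltnP a b => ab_n.
    have b_n : (b < n)%N by lia.
    have k_lt : (b - a < b.+1)%N by lia.
    have k1_lt : (b - a.+1 < b.+1)%N by lia.
    have := @triangle_heightE t a (Ordinal b_n) (Ordinal k_lt) t_magog.
    have := @triangle_heightE t a.+1 (Ordinal b_n) (Ordinal k1_lt) t_magog.
    have := t_lt (Ordinal b_n) (Ordinal k1_lt) (Ordinal k_lt).
    by rewrite /=; lia.
  (* For [b <= a] they come from consecutive rows on one diagonal, and the diagonal inequality
     compares them. *)
  have a_n : (a < n)%N by lia.
  have a1_n : (a.+1 < n)%N by lia.
  have k_lt : (a - b < a.+1)%N by lia.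
  have k1_lt : (a.+1 - b < a.+2)%N by lia.
  have := @triangle_heightE t b (Ordinal a_n) (Ordinal k_lt) t_magog.
  have := @triangle_heightE t b (Ordinal a1_n) (Ordinal k1_lt) t_magog.
  have := t_diag (Ordinal a_n) (Ordinal a1_n) (Ordinal k_lt) (Ordinal k1_lt) erefl.
  by rewrite !(triangle_heightC t b) /=; lia.
have bound a b : (a <= b)%N -> (triangle_height t a b <= n.-1 - b)%N.
  move=> ab; have [out|b_n] := leqP n b; first by rewrite triangle_height_out //; lia.
  have k_lt : (b - a < b.+1)%N by lia.
  have := @triangle_heightE t a (Ordinal b_n) (Ordinal k_lt) t_magog.
  have := @magog_triangle_le t (Ordinal b_n) (Ordinal k_lt) t_magog.
  by rewrite /=; lia.
split=> [a b|a a' b /subnK <-|a b]; first exact: triangle_heightC.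
- by elim: (a' - a)%N => [//|m IHm]; apply: leq_trans (step _ _) IHm.
- have [/bound //|ba] := leqP a b.
  by rewrite triangle_heightC; apply: leq_trans (bound _ _ (ltnW ba)) _; lia.
Qed.

Lemma triangle_height_inj t t' : magog_triangle t -> magog_triangle t' ->
  (forall a b, triangle_height t a b = triangle_height t' a b) -> t = t'.
Proof.
move=> t_magog t'_magog tt'; apply/ffunP=> r; apply/ffunP=> k.
have rk : (r - k + k = r)%N by have := ltn_ord k; lia.
apply: (@addIr _ (- k.+1%:Z)).
by rewrite -(triangle_heightE t_magog rk) tt' (triangle_heightE t'_magog rk).
Qed.

Lemma triangle_of_heightE h r k :
  triangle_of_height h r k = (h (r - k) r + k.+1)%N%:Z.
Proof. by rewrite !ffunE. Qed.

Lemma magog_triangle_of_height h :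
  height_array n h -> magog_triangle (triangle_of_height h).
Proof.
move=> [hC h_mono h_bound].
split=> [r k|r k k1 k1E|r r1 k k1 r1E k1E|r k rE]; rewrite !triangle_of_heightE.
- by have := h_bound (r - k)%N r; have := ltn_ord k; have := ltn_ord r; lia.
- by have := h_mono (r - k1)%N (r - k)%N r; rewrite k1E; lia.
- have -> : (r1 - k1 = r - k)%N by lia.
  have := h_mono r r1 (r - k)%N.
  by rewrite !(hC _ (r - k)%N); lia.
(* In the bottom row the bound forces height 0. *)
- by have := h_bound (r - k)%N r; lia.
Qed.

Lemma triangle_of_heightK h a b : height_array n h ->
  triangle_height (triangle_of_height h) a b = h a b.
Proof.
move=> h_array; have [hC _ h_bound] := h_array.
wlog ab : a b / (a <= b)%N => [IH|].
  have [/IH//|/ltnW ba] := leqP a b.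
  by rewrite triangle_heightC hC IH.
have [out|b_n] := leqP n b.
  by rewrite triangle_height_out; last lia; have := h_bound a b; lia.
have k_lt : (b - a < b.+1)%N by lia.
have := @triangle_heightE _ a (Ordinal b_n) (Ordinal k_lt)
  (magog_triangle_of_height h_array).
by rewrite triangle_of_heightE /= subKn //; lia.
Qed.

End Heights.

(** * Composing the bijections *)

Lemma height_pp_bij n :
  set_bij [set t : triangle n | magog_triangle t]%classic
          [set pi : {fset lattice_point} | tsscpp n pi]%classic
          (fun t => height_pp n (triangle_height t)).
Proof.
split.
- by move=> t t_magog; apply/height_pp_tsscpp/triangle_height_array.
- move=> t t' /set_mem t_magog /set_mem t'_magog /= tt'.
  apply: triangle_height_inj => //.
  by apply: height_pp_inj tt'; exact: triangle_height_array.
- move=> pi pi_tsscpp; have h_array := pp_height_array pi_tsscpp.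
  exists (triangle_of_height n (pp_height n pi)); first exact: magog_triangle_of_height.
  rewrite -[RHS](pp_heightK pi_tsscpp); congr height_pp.
  by apply/funext=> a; apply/funext=> b; exact: triangle_of_heightK.
Qed.

Local Open Scope classical_set_scope.

Theorem theorem3p2 (n : nat) (hn : (0 < n)%N) :
  set_bij [set A : 'M[int]_n | magog_matrix A]
          [set t : triangle n | magog_triangle t]
          (@triangle_of_matrix n)
  /\ exists f : 'M[int]_n -> {fset lattice_point},
       set_bij [set A : 'M[int]_n | magog_matrix A]
               [set pi : {fset lattice_point} | tsscpp n pi] f.
Proof.
split; first exact: triangle_of_matrix_bij.
by eexists; apply: set_bij_comp (triangle_of_matrix_bij n) (height_pp_bij n).
Qed.
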